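(* Let $\mathcal I$ be a compact topological spherical building and let $\mathcal A$ be an apartment of $\mathcal I$. Suppose that one of the following holds: (i) $\mathcal I$ is of type $A_1$ and its space of vertices $\mathcal I^{\langle 0\rangle}$ has no isolated point; (ii) $\mathcal I$ is of type $A_2$, its space of edges $\mathcal I^{\langle 1\rangle}$ has no isolated point, and $\mathcal I$ is topologically strongly transitive and topologically Moufang. Then $\overline{\operatorname{Mor}_{inj}(\mathcal A,\mathcal I)}^g=\operatorname{Mor}(\mathcal A,\mathcal I)$.
   Context: A topological spherical building is a spherical building $\mathcal I$, of dimension $d$, whose set of vertices $\mathcal I^{\langle 0\rangle}$ has a topology such that for all $k\in\{0,\dots,d\}$ the set $\mathcal I^{\langle k\rangle}$ of $k$-simplices is closed for the topology induced by $(\mathcal I^{\langle 0\rangle})^{k+1}$. It is compact if $\mathcal I^{\langle 0\rangle}$ is compact. $\operatorname{Cham}(\mathcal I)=\mathcal I^{\langle d\rangle}$ is the space of (closed) Weyl chambers. The maximal apartment system is used. The topology $\mathcal T_{lc}$ on $\mathcal I$ is the one for which $x_n\to x$ iff there are chambers $D_n\ni x_n$ converging in $\operatorname{Cham}(\mathcal I)$ to a chamber $D\ni x$ such that the images of $x_n$ under the type-preserving isometries $D_n\to D$ converge to $x$. An automorphism of the topological building is a type-preserving building automorphism that is a homeomorphism for $\mathcal T_{lc}$; $G$ is the group of these. $\mathcal I$ is topologically strongly transitive if $G$ acts transitively on pairs (chamber $\subset$ apartment). $\mathcal I$ is topologically Moufang if for every root (half-apartment) $\alpha$ of $\mathcal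 I$, the group $U_\alpha=\{g\in G: g(\alpha)=\alpha\}$ acts transitively on the set of apartments containing $\alpha$. $\operatorname{Mor}(\mathcal A,\mathcal I)$ is the set of all (not necessarily injective) type-preserving simplicial morphisms $\mathcal A\to\mathcal I$, with the topology induced by the product topology on $\operatorname{Cham}(\mathcal I)^{\operatorname{Cham}(\mathcal A)}$. $\operatorname{Mor}_{inj}(\mathcal A,\mathcal I)$ is the subset of injective morphisms (marked apartments), and $\overline{\operatorname{Mor}_{inj}(\mathcal A,\mathcal I)}^g$ is its closure in $\operatorname{Mor}(\mathcal A,\mathcal I)$. A building of type $A_1$ is a set of points in which the apartments are the unordered pairs of distinct points; a building of type $A_2$ is a rank 2 building whose apartments are hexagons. *)

(* Defs.v *)
From HB Require Import structures.
From mathcomp Require Import all_boot all_order all_algebra all_fingroup.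
From mathcomp Require Import finmap all_classical all_reals all_analysis.

Set Implicit Arguments.
Unset Strict Implicit.
Unset Printing Implicit Defensive.

Import Order.TTheory GRing.Theory Num.Theory.
Import numFieldNormedType.Exports.

Local Open Scope classical_set_scope.

(* A simplicial complex is given by its set of nonempty simplices, each simplex
   being identified with the finite set of its vertices. *)

Definition is_simplicial_complex (V : choiceType) (K : set {fset V}) : Prop :=
  ~ K fset0 /\
  forall s t : {fset V}, K s -> (t `<=` s)%fset -> t != fset0 -> K t.

Definition verts (V : choiceType) (K : set {fset V}) : set V :=
  [set v | exists2 s, K s & v \in s].

Definition image_complex (V V' : choiceType) (f : V -> V') (K : set {fset V}) :
  set {fset V'} := [set t | exists2 s, K s & t = (f @` s)%fset].

(* Only the values of [f] on the vertices of [K] matter. *)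
Definition complex_iso (V V' : choiceType) (f : V -> V') (K : set {fset V})
    (L : set {fset V'}) : Prop :=
  (forall v w, verts K v -> verts K w -> f v = f w -> v = w) /\
  L = image_complex f K.

Section Coxeter.
Local Open Scope group_scope.

(* [W] is generated by the involutions in [S], and the relations
   [(s * t) ^+ #[s * t] = 1] form a presentation of [W]; the relation for
   [s = t] reads [s ^+ 2 = 1]. *)
Definition coxeter_system (W : finGroupType) (S : {set W}) : Prop :=
  [/\ <<S>> = [set: W]%SET,
      (forall s, s \in S -> #[s] = 2%N) &
      forall (H : groupType) (f : W -> H),
        (forall s t, s \in S -> t \in S -> (f s * f t) ^+ #[s * t] = 1) ->
        exists phi : {multiplicative W -> H}, forall s, s \in S -> phi s = f s].

(* The chamber [w] has one vertex of type [s] for every [s] in [S], namely the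
   coset of [w] modulo the maximal standard parabolic subgroup <<S :\ s>>. *)
Definition coxeter_vertex (W : finGroupType) (S : {set W}) (w s : W) :
  (W * {set W})%type := (s, w *: <<(S :\ s)%SET>>).

Definition coxeter_complex (W : finGroupType) (S : {set W}) :
    set {fset (W * {set W})%type} :=
  [set t | exists (w : W) (J : {set W}),
     [/\ J != finset.set0, J \subset S &
         t = [fset coxeter_vertex S w s | s in J]%fset]].

End Coxeter.

Definition finite_coxeter_complex (d : nat) (V : choiceType)
    (A : set {fset V}) : Prop :=
  exists (W : finGroupType) (S : {set W}),
    [/\ coxeter_system S, #|S| = d.+1 &
        exists f : (W * {set W})%type -> V, complex_iso f (coxeter_complex S) A].

Definition apartment_system (d : nat) (V : choiceType) (K : set {fset V})
    (E : set (set {fset V})) : Prop :=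
  [/\ (forall A, E A -> A `<=` K /\ finite_coxeter_complex d A),
      (forall s t, K s -> K t -> exists A, [/\ E A, A s & A t]) &
      forall A A' s t, E A -> E A' -> A s -> A t -> A' s -> A' t ->
        exists f : V -> V,
          complex_iso f A A' /\ (forall v, v \in s \/ v \in t -> f v = v)].

Definition tuple_simplex (V : choiceType) (n : nat) (c : 'I_n -> V) : {fset V} :=
  [fset c i | i : 'I_n]%fset.

Definition ordered_simplices (V : choiceType) (K : set {fset V}) (k : nat) :
  set ('I_k.+1 -> V) := [set c | injective c /\ K (tuple_simplex c)].
Arguments ordered_simplices {V} K k.

(* [ordered_simplices simp k] consists of all orderings of all k-simplices.  The
   type function is unique up to a permutation of the types. *)
Record topBuilding (d : nat) := TopBuilding {
  vertex :> topologicalType;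
  simp : set {fset vertex};
  typ : vertex -> 'I_d.+1;
  simp_complex : is_simplicial_complex simp;
  simp_vertex : forall v : vertex, simp [fset v]%fset;
  simp_apartments : exists E, apartment_system d simp E;
  typ_inj : forall s, simp s -> {in s &, injective typ};
  simp_closed : forall k : nat, (k <= d)%N ->
    @closed {ptws 'I_k.+1 -> vertex} (ordered_simplices simp k) }.

Section Building.
Variables (d : nat) (I : topBuilding d).

(* The maximal apartment system is the union of all the apartment systems. *)
Definition apartment (A : set {fset I}) : Prop :=
  exists2 E, apartment_system d (@simp d I) E & E A.

(* A chamber is recorded as the family of its vertices indexed by their types;
   the topology of [Cham] is thus induced by that of vertex^(d+1). *)
Definition Cham_set : set {ptws 'I_d.+1 -> I} :=
  [set c | (forall i, typ (c i) = i) /\ simp (tuple_simplex c)].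

Definition Cham : topologicalType := set_type Cham_set.

Definition cvertex (C : Cham) : 'I_d.+1 -> I := \val C.

Definition csimplex (C : Cham) : {fset I} := tuple_simplex (cvertex C).

Definition ChamIn (A : set {fset I}) : Type := {C : Cham | A (csimplex C)}.

Definition mor_set (A : set {fset I}) : set (verts A -> I) :=
  [set f | (forall v : verts A, typ (f v) = typ (\val v)) /\
           forall s : {fset verts A}, A [fset \val v | v in s]%fset ->
             simp [fset f v | v in s]%fset].
Arguments mor_set A : clear implicits.

Lemma ChamIn_verts (A : set {fset I}) (C : ChamIn A) (i : 'I_d.+1) :
  cvertex (sval C) i \in verts A.
Proof.
apply/mem_set; exists (csimplex (sval C)); first exact: (svalP C).
by apply/imfsetP; exists i.
Qed.

Definition ChamIn_vertex (A : set {fset I}) (C : ChamIn A) (i : 'I_d.+1) :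
  verts A := SigSub (ChamIn_verts C i).

Lemma mor_cham_subproof (A : set {fset I}) (f : mor_set A) (C : ChamIn A) :
  (\val f \o ChamIn_vertex C : {ptws 'I_d.+1 -> I}) \in Cham_set.
Proof.
case: f => /= f /set_mem[ftyp fsimp]; apply/mem_set; split=> [i|].
  rewrite /= ftyp /=.
  by case: C => -[c cP] /= cA; have [+ _] := set_mem cP; apply.
have -> : tuple_simplex (f \o ChamIn_vertex C)
    = [fset f v | v in tuple_simplex (ChamIn_vertex C)]%fset.
  apply/fsetP => x; apply/imfsetP/imfsetP => /= [[i _ ->]|[v /imfsetP[i _ ->] ->]].
    by exists (ChamIn_vertex C i) => //; apply/imfsetP; exists i.
  by exists i.
apply: fsimp.
suff -> : [fset \val v | v in tuple_simplex (ChamIn_vertex C)]%fset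
    = csimplex (sval C) by exact: svalP C.
apply/fsetP => x; apply/imfsetP/imfsetP => /= [[v /imfsetP[i _ ->] ->]|[i _ ->]].
  by exists i.
by exists (ChamIn_vertex C i) => //; apply/imfsetP; exists i.
Qed.

Definition mor_cham (A : set {fset I}) (f : mor_set A) : {ptws ChamIn A -> Cham} :=
  fun C => SigSub (mor_cham_subproof f C).

(* The type-preserving simplicial morphisms from [A] to the building, with the
   topology induced by the product topology on Cham(I)^Cham(A). *)
Definition Mor (A : set {fset I}) : topologicalType :=
  initial_topology (@mor_cham A).

Definition mor_fun (A : set {fset I}) (f : Mor A) : verts A -> I :=
  \val (f : mor_set A).

Definition Mor_inj (A : set {fset I}) : set (Mor A) :=
  [set f | injective (mor_fun f)].

Definition type_A1 : Prop :=
  d = 0%N /\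
  forall A, apartment A <->
    exists x y : I, x <> y /\ A = [set [fset x]%fset; [fset y]%fset].

Definition hexagon (V : choiceType) (h : 'I_6 -> V) : set {fset V} :=
  [set s | exists i, s = [fset h i]%fset \/ s = [fset h i; h (ordS i)]%fset].

Definition type_A2 : Prop :=
  d = 1%N /\
  forall A, apartment A -> exists2 h : 'I_6 -> I, injective h & A = hexagon h.

(* A folding of [A] is an idempotent type-preserving endomorphism of [A] such
   that every chamber of its image is the image of exactly one chamber of [A]
   not contained in its image. *)
Definition folding (A : set {fset I}) (f : I -> I) : Prop :=
  [/\ (forall v, verts A v -> typ (f v) = typ v),
      image_complex f A `<=` A,
      (forall v, verts A v -> f (f v) = f v) &
      forall C : Cham, image_complex f A (csimplex C) ->
        exists! C' : Cham,
          [/\ A (csimplex C'), ~ image_complex f A (csimplex C') &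
              (f @` csimplex C')%fset = csimplex C]].

Definition half_apartment (a : set {fset I}) : Prop :=
  exists A f, [/\ apartment A, folding A f & a = image_complex f A].

Record automorphism := Automorphism {
  aut_fun :> I -> I;
  aut_inv : I -> I;
  aut_funK : cancel aut_fun aut_inv;
  aut_invK : cancel aut_inv aut_fun;
  aut_typ : forall v, typ (aut_fun v) = typ v;
  aut_simp : forall s, simp (aut_fun @` s)%fset <-> simp s }.

Lemma inv_aut_typ (g : automorphism) v : typ (aut_inv g v) = typ v.
Proof. by rewrite -(aut_typ g) aut_invK. Qed.

Lemma inv_aut_simp (g : automorphism) s :
  simp (aut_inv g @` s)%fset <-> simp s.
Proof.
rewrite -(aut_simp g (aut_inv g @` s)%fset).
suff -> : (g @` (aut_inv g @` s))%fset = s by [].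
apply/fsetP => x; apply/imfsetP/idP => /= [[_ /imfsetP[y /= ys ->] ->]|xs].
  by rewrite aut_invK.
by exists (aut_inv g x); rewrite ?aut_invK// in_imfset.
Qed.

Definition inv_aut (g : automorphism) : automorphism :=
  Automorphism (aut_invK g) (aut_funK g) (inv_aut_typ g) (inv_aut_simp g).

End Building.

Arguments Mor_inj {d I} A.
Arguments type_A1 {d} I.
Arguments type_A2 {d} I.

Section Realization.
Local Open Scope ring_scope.
Variables (R : realType) (d : nat) (I : topBuilding d).

(* Points are given by their barycentric coordinates. *)
Definition realization_set : set (I -> R) :=
  [set x | exists2 s : {fset I}, simp s &
     [/\ forall v, v \in s -> 0 < x v, forall v, v \notin s -> x v = 0 &
         \sum_(v <- s) x v = 1]].

Definition realization : Type := set_type realization_set.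

HB.instance Definition _ := Choice.on realization.

Definition coord (x : realization) : I -> R := \val x.

Definition in_cham (x : realization) (C : Cham I) : Prop :=
  forall v, coord x v != 0 -> v \in csimplex C.

(* The type-preserving isometry between two closed chambers is the restriction
   of a linear isometry between simplicial cones; hence it preserves the
   barycentric coordinates with respect to the vertices of each type, and the
   convergence in D of the images of the x_n is that of these coordinates. *)
Definition lc_cvg (u : nat -> realization) (x : realization) : Prop :=
  exists (D_ : nat -> Cham I) (D : Cham I),
    [/\ forall n, in_cham (u n) (D_ n),
        in_cham x D,
        D_ n @[n --> \oo] --> D &
        forall i : 'I_d.+1,
          coord (u n) (cvertex (D_ n) i) @[n --> \oo] --> coord x (cvertex D i)].

(* T_lc is the finest topology for which [lc_cvg u x] implies that [u] converges
   to [x]. *)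
Definition lc_open : set (set realization) :=
  [set U | forall u x, lc_cvg u x -> U x -> \forall n \near \oo, U (u n)].

Lemma lc_openT : lc_open setT.
Proof. by move=> u x _ _; exact: nearW. Qed.

Lemma lc_openI : setI_closed lc_open.
Proof.
move=> U V oU oV u x ux [Ux Vx].
by apply: filterS2 (oU _ _ ux Ux) (oV _ _ ux Vx) => n; split.
Qed.

Lemma lc_open_bigcup (J : Type) (F : J -> set realization) :
  (forall j, lc_open (F j)) -> lc_open (\bigcup_j F j).
Proof.
move=> oF u x ux [j _ Fjx].
by apply: filterS (oF j u x ux Fjx) => n; exists j.
Qed.

HB.instance Definition _ := isOpenTopological.Build realization
  lc_openT lc_openI lc_open_bigcup.

Lemma realization_act_subproof (g : automorphism I) (x : realization) :
  coord x \o aut_inv g \in realization_set.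
Proof.
case: x => x xP; have [s ss [xpos x0 x1]] := set_mem xP; apply/mem_set.
have gs v : (v \in (g @` s)%fset) = (aut_inv g v \in s).
  apply/imfsetP/idP => /= [[w ws ->]|vs]; first by rewrite aut_funK.
  by exists (aut_inv g v); rewrite ?aut_invK.
exists (g @` s)%fset; first exact/aut_simp.
split=> [v|v|]; rewrite ?gs.
- exact: xpos.
- exact: x0.
rewrite big_imfset /=; last by move=> v w _ _ /(can_inj (aut_funK g)).
by rewrite -[RHS]x1; apply: eq_bigr => v _; rewrite /coord /= aut_funK.
Qed.

Definition realization_act (g : automorphism I) (x : realization) : realization :=
  SigSub (realization_act_subproof g x).

(* The group G of the automorphisms that are homeomorphisms for T_lc. *)
Definition top_aut : set (automorphism I) :=
  [set g | continuous (realization_act g) /\ continuous (realization_act (inv_aut g))].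

Definition top_strongly_transitive : Prop :=
  forall (A A' : set {fset I}) (C C' : Cham I),
    apartment A -> apartment A' -> A (csimplex C) -> A' (csimplex C') ->
    exists2 g, top_aut g &
      image_complex g A = A' /\ (g @` csimplex C)%fset = csimplex C'.

Definition top_moufang : Prop :=
  forall (a A A' : set {fset I}),
    half_apartment a -> apartment A -> apartment A' -> a `<=` A -> a `<=` A' ->
    exists2 g, top_aut g & image_complex g a = a /\ image_complex g A = A'.

End Realization.

(* Main.v *)
Require Import Defs.
From mathcomp Require Import all_boot all_order all_algebra all_fingroup.
From mathcomp Require Import finmap all_classical all_reals all_analysis.

Set Implicit Arguments.
Unset Strict Implicit.
Unset Printing Implicit Defensive.

Local Open Scope classical_set_scope.

(** In type A1 a morphism that is not injective sends the two points of the
    apartment to the same point p, and it is the limit of the morphisms obtained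
    by moving one of the two images to points t <> p that tend to p.

    In type A2 the incidence graph is that of a projective plane, of which the
    vertices are the points and the lines, and a morphism from an apartment is a
    closed walk of length 6 in this graph.  Closedness of the incidence relation
    and compactness make the join of distinct vertices of one type a continuous
    operation ([join_cvg]), because a cluster point of the joins of v_n and w_n
    is incident to both limits, hence is their join.

    The other ingredient is that each vertex incident to c is a limit of other
    vertices incident to c ([pencil_limitT]).  Perspectivities transport this
    property along paths.  In a thick plane it therefore holds everywhere or
    nowhere, and if it holds nowhere then every chamber is isolated.  Thickness
    comes from transitivity on chambers: if some vertex has only two neighbours,
    so has every vertex of its type; then the plane is finite, hence discrete, and
    its chambers are isolated.

    A closed walk (x0, ..., x5) that is not injective has a fold x_i = x_(i+2),
    and up to rotation there are two shapes.
    - Walks (p, m, p, l, q, l) with m <> l and q <> p: move the second p to t on m;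
      the line l through p and q becomes the join of t and q
      ([approximable_bent]).
    - Walks (p, b, p, d, p, f): first make b, d, f distinct by moving them among
      the neighbours of p, then move d off p by turning it about its neighbour
      r <> p; it now meets b and f in two vertices different from p
      ([approximable_star3], [approximable_star]).
    The limits involved are those of the pointwise topology, to which the topology
    on the morphisms reduces ([Mor_cvg]). *)

(** * Topological and combinatorial preliminaries *)

Lemma initial_cvg (S : choiceType) (T : topologicalType) (f : S -> T)
    (F : set_system S) (s : S) :
  Filter F -> f @ F --> f s -> F --> (s : initial_topology f).
Proof.
move=> FF fF U; rewrite nbhsE => -[_ [[B Bop <-] Bfs] BU].
by apply: filterS BU _; apply: fF; exact: open_nbhs_nbhs.
Qed.

Lemma ptws_cvg (J : Type) (V : topologicalType) (F : set_system (J -> V))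
    (x : J -> V) :
  Filter F -> (forall j, (fun y => y j) @ F --> x j) ->
  F --> (x : {ptws J -> V}).
Proof. by move=> FF Fx; apply/cvg_sup => j; exact: initial_cvg. Qed.

Lemma ord2_neq_eq (a b c : 'I_2) : a <> b -> b <> c -> a = c.
Proof.
move=> /eqP ab /eqP bc; apply/eqP; move: a b c ab bc.
by case=> [[|[|a]] ?] [[|[|b]] ?] [[|[|c]] ?].
Qed.

Lemma imfset_fset1 (S T : choiceType) (g : S -> T) (a : S) :
  (g @` [fset a])%fset = [fset g a]%fset.
Proof.
apply/fsetP => u; rewrite inE; apply/imfsetP/eqP => [[v /= + ->]|->].
  by rewrite inE => /eqP ->.
by exists a; rewrite /= ?inE.
Qed.

Lemma imfset_fset2 (S T : choiceType) (g : S -> T) (a b : S) :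
  (g @` [fset a; b])%fset = [fset g a; g b]%fset.
Proof. by rewrite imfsetU !imfset_fset1. Qed.

Lemma tuple_simplex2 (V : choiceType) (c : 'I_2 -> V) (i j : 'I_2) :
  i <> j -> tuple_simplex c = [fset c i; c j]%fset.
Proof.
move=> ij; apply/fsetP => u; rewrite !inE; apply/imfsetP/orP => /= [[k _ ->]|].
  have [->|/eqP ki] := eqVneq k i; [by left|right].
  by rewrite (ord2_neq_eq ki ij).
by case=> /eqP ->; [exists i|exists j].
Qed.

Lemma not_isolated_dnbhs (T : topologicalType) (x : T) :
  isolated [set: T] = set0 -> ProperFilter x^'.
Proof.
move=> iso; apply: Build_ProperFilter_ex => P xP; apply: contrapT => nP.
suff : isolated [set: T] x by rewrite iso.
split; first exact/mem_set.
exists [set y | y != x -> P y] => //; rewrite setIT.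
apply/seteqP; split=> [y /= yP|y ->/=]; last by rewrite eqxx.
by apply: contrapT => /eqP /yP Py; apply: nP; exists y.
Qed.

Lemma closure_filter (T : Type) (V : topologicalType) (F : set_system T)
    (y : T -> V) (B : set V) (x : V) :
  ProperFilter F -> y @ F --> x -> (\forall t \near F, B (y t)) -> closure B x.
Proof.
move=> FF yx yB W xW; have yW : \forall t \near F, W (y t) by exact: yx.
by have [t ?] := filter_ex (filterI yB yW); exists (y t).
Qed.

(** * Projective planes with a compact space of points and lines *)

(** Points and lines are treated alike, so that each statement about the plane
    also covers its dual; [typ] tells them apart. *)
Record projective_plane (V : Type) (adj : V -> V -> Prop) (typ : V -> 'I_2) :
    Prop := ProjectivePlane {
  adjC : forall v w, adj v w -> adj w v;
  adj_typ : forall v w, adj v w -> typ v <> typ w;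
  join_ex : forall v w, typ v = typ w -> exists2 u, adj u v & adj u w;
  join_uniq : forall v w u u', v <> w ->
    adj u v -> adj u w -> adj u' v -> adj u' w -> u = u';
  adj_other : forall v w, exists2 u, adj v u & u <> w }.

Section Plane.
Variables (V : topologicalType) (adj : V -> V -> Prop) (typ : V -> 'I_2).
Hypothesis plane : projective_plane adj typ.
Hypothesis adj_closed : closed [set vw : V * V | adj vw.1 vw.2].
Hypothesis V_compact : compact [set: V].

Let adjC := adjC plane.
Let adj_typ := adj_typ plane.
Let join_ex := join_ex plane.
Let join_uniq := join_uniq plane.
Let adj_other := adj_other plane.

Lemma adj2_typ u v w : adj u v -> adj u w -> typ v = typ w.
Proof.
move=> uv uw; apply: (@ord2_neq_eq _ (typ u)); last exact: adj_typ.
exact/adj_typ/adjC.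
Qed.

(** The closed graph argument behind [join_cvg]: the pairs (c t, a t) have
    (c0, a0) in their closure because [a] converges, not merely clusters. *)
Lemma cluster_adj (T : Type) (F : set_system T) (a c : T -> V) (a0 c0 : V) :
  Filter F -> cluster (c @ F) c0 -> a @ F --> a0 ->
  (\forall t \near F, adj (c t) (a t)) -> adj c0 a0.
Proof.
move=> FF Fc Fa Fca; suff: [set vw : V * V | adj vw.1 vw.2] (c0, a0) by [].
apply: adj_closed => B [[P Q] /= [Pc Qa] PQB].
have [_ [[t [Qt ct] <-] Pt]] :
    c @` [set t | Q (a t) /\ adj (c t) (a t)] `&` P !=set0.
  apply: Fc Pc; have : \forall t \near F, Q (a t) /\ adj (c t) (a t).
    by apply: filterI => //; exact: Fa.
  by apply: filterS => t ?; exists t.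
by exists (c t, a t); split=> //; exact: PQB.
Qed.

(** Continuity of joins.  If [c] left a neighbourhood [U] of [c0] frequently, it
    would have a cluster point along the part of [F] where it is out of [U]; this
    point is incident to [a0] and [b0], hence equal to [c0], inside [U]. *)
Lemma join_cvg (T : Type) (F : set_system T) (a b c : T -> V) (a0 b0 c0 : V) :
  Filter F -> a @ F --> a0 -> b @ F --> b0 -> a0 <> b0 ->
  adj c0 a0 -> adj c0 b0 ->
  (\forall t \near F, adj (c t) (a t)) ->
  (\forall t \near F, adj (c t) (b t)) -> c @ F --> c0.
Proof.
move=> FF Fa Fb ab0 ca0 cb0 Fca Fcb U Uc0; rewrite nbhs_filterE.
apply: contrapT => FU; pose G := within (c @^-1` (~` U)) F.
have GF A : F A -> G A by rewrite /G /within /= => FA; apply: filterS FA => t ? _.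
have GG : ProperFilter G.
  apply: Build_ProperFilter_ex => A GA; apply: contrapT => A0; apply: FU.
  move: GA; rewrite /G /within /= /fmap /=.
  apply: filterS => t At; apply: contrapT => Ut.
  by apply: A0; exists t; exact: At.
have [z [_ zG]] : [set: V] `&` cluster (c @ G) !=set0.
  by apply: V_compact; exact: filterT.
have za0 : adj z a0.
  by apply: cluster_adj zG _ (GF _ Fca) => W /Fa; exact: GF.
have zb0 : adj z b0.
  by apply: cluster_adj zG _ (GF _ Fcb) => W /Fb; exact: GF.
have zc0 : z = c0 by exact: join_uniq ab0 _ _ _ _.
have [w [nUw Uw]] : ~` U `&` U !=set0.
  by apply: zG; [exact: withinT|rewrite zc0].
exact: nUw.
Qed.

Lemma pencil_closed v : closed [set u | adj u v].
Proof.
move=> w wv; apply: (@cluster_adj _ (globally [set u | adj u v]) (cst v) id) => //.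
- by move: wv; rewrite closureEcluster.
- exact: cvg_cst.
Qed.

(** The space is T1: a vertex is the intersection of the closed sets of the
    neighbours of two of its neighbours. *)
Lemma plane_closed1 (v : V) : closed [set v].
Proof.
have [u1 vu1 _] := adj_other v v; have [u2 vu2 u21] := adj_other v u1.
suff -> : [set v] = [set u | adj u u1] `&` [set u | adj u u2].
  by apply: closedI; exact: pencil_closed.
apply/seteqP; split=> [_ ->//|w [/= wu1 wu2]].
by apply: join_uniq (nesym u21) _ _ _ _.
Qed.

Lemma near_neq (v w : V) : v <> w -> \forall u \near v, u <> w.
Proof.
move=> vw; have : open (~` [set w]) by rewrite openC; exact: plane_closed1.
by rewrite openE => /(_ v); apply.
Qed.

Definition join (v w : V) : V := xget v [set u | adj u v /\ adj u w].

Lemma joinP v w : typ v = typ w -> adj (join v w) v /\ adj (join v w) w.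
Proof.
move=> vw; have [u uv uw] := join_ex vw.
by apply: (@xgetPex _ v [set u | adj u v /\ adj u w]); exists u.
Qed.

Definition thin_at (v : V) :=
  exists u w, forall x, adj v x -> x = u \/ x = w.

Lemma thin_at_pair v a b x :
  thin_at v -> adj v a -> adj v b -> a <> b -> adj v x -> x = a \/ x = b.
Proof.
move=> [u [w uw]] /uw + /uw + + /uw.
by move=> [->|->] [->|->] ab [->|->]; auto; case: ab.
Qed.

(** The plane is a single triangle.  Take [l] as a line: it has exactly two
    points [p] and [q]; let [s] be the other point of a second line [m] through
    [q].  The line through [p] and a further point [z] has no third point but
    meets [m], which forces [z] to be [q] or [s]. *)
Lemma thin_finite (l : V) :
  (forall k, typ k = typ l -> thin_at k) -> finite_set [set: V].
Proof.
move=> thin; have [p lp _] := adj_other l l; have [q lq qp] := adj_other l p.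
have [m qm ml] := adj_other q l; have [s ms sq] := adj_other m q.
have tm : typ m = typ l by apply: adj2_typ qm _; exact: adjC.
have nls : ~ adj l s.
  by move=> ls; apply: ml; apply: (join_uniq sq) => //; exact: adjC.
have tpq : typ p = typ q by exact: adj2_typ lp lq.
have tps : typ p = typ s by rewrite tpq; apply: adj2_typ _ ms; exact: adjC.
have ps : p <> s by move=> e; apply: nls; rewrite -e.
have [n np ns] := join_ex tps.
have points z : typ z = typ p -> [\/ z = p, z = q | z = s].
  move=> tz; have [->|/eqP zp] := eqVneq z p; first exact: Or31.
  have [k kz kp] := join_ex tz.
  have tk : typ k = typ l by apply: (adj2_typ (u := p)); exact: adjC.
  have [x xk xm] : exists2 x, adj x k & adj x m by apply: join_ex; rewrite tm.
  have := thin_at_pair (thin _ tm) (adjC qm) ms (nesym sq) (adjC xm).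
  have := thin_at_pair (thin _ tk) kz kp zp (adjC xk).
  move=> [->|->]; first by case=> ->; [exact: Or32|exact: Or33].
  by case=> // e; case: qp.
have lines y : typ y = typ l -> [\/ y = l, y = m | y = n].
  move=> ty; have [a ya _] := adj_other y y; have [b yb ba] := adj_other y a.
  have pt x : adj y x -> typ x = typ p.
    move=> yx; apply: (@ord2_neq_eq _ (typ l)); last exact: adj_typ.
    by rewrite -ty; exact/adj_typ/adjC.
  have pq := nesym qp; have sp := nesym ps; have qs := nesym sq.
  have yl : adj y p -> adj y q -> y = l by move=> yp yq; exact: (join_uniq pq).
  have ym : adj y q -> adj y s -> y = m.
    by move=> yq ys; apply: (join_uniq qs) => //; exact: adjC.
  have yn : adj y p -> adj y s -> y = n by move=> yp ys; exact: (join_uniq ps).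
  have := points b (pt _ yb); have := points a (pt _ ya).
  case=> ea; case=> eb;
    move: ya yb; rewrite ea eb => ya yb; try by case: ba; rewrite ea eb.
  - by apply: Or31; exact: yl.
  - by apply: Or33; exact: yn.
  - by apply: Or31; exact: yl.
  - by apply: Or32; exact: ym.
  - by apply: Or33; exact: yn.
  - by apply: Or32; exact: ym.
apply: (@sub_finite_set _ _ [set` [:: p; q; s; l; m; n]]); last first.
  exact: finite_seq.
move=> z _.
have [tz|/eqP tz] := eqVneq (typ z) (typ l).
  by case: (lines z tz) => -> /=; rewrite !inE eqxx ?orbT.
have tzp : typ z = typ p by apply: ord2_neq_eq tz _; exact: adj_typ.
by case: (points z tzp) => -> /=; rewrite !inE eqxx ?orbT.
Qed.

(* The types are kept so that w' has joins with the vertices of the type of w. *)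
Hypothesis edge_limit : forall v w, adj v w ->
  forall P Q, nbhs v P -> nbhs w Q -> exists v' w',
    [/\ P v', Q w', adj v' w', typ w' = typ w & ~ (v' = v /\ w' = w)].
(* Automorphisms provide this when they are transitive on chambers. *)
Hypothesis thin_homog : forall v w, typ v = typ w -> thin_at v -> thin_at w.

(** A thin vertex would make all vertices of its type thin, and the plane finite
    and T1, hence discrete, in contradiction with [edge_limit]. *)
Lemma plane_thick v u w : exists x, [/\ adj v x, x <> u & x <> w].
Proof.
apply: contrapT => nx; have thin_v : thin_at v.
  exists u, w => x vx; apply: contrapT => /not_orP[xu xw].
  by apply: nx; exists x.
have fin : finite_set [set: V].
  by apply: (@thin_finite v) => k kv; apply: thin_homog thin_v.
have T1 : accessible_space V.
  move=> x y /eqP xy; exists (~` [set y]); rewrite !inE; split=> //=.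
  by rewrite openC; exact: plane_closed1.
have disc (x : V) : nbhs x [set x].
  apply: open_nbhs_nbhs; split=> //; rewrite -[X in open X]setCK openC.
  by move/accessible_finite_set_closed: T1; apply; exact: sub_finite_set fin.
have [x vx _] := adj_other v v.
by have [_ [_ [-> -> _ _]]] := edge_limit vx (disc v) (disc x); apply.
Qed.

(** * Vertices incident to a given vertex are not isolated *)

Definition pencil_limit c v := limit_point [set u | adj c u] v.

Let pencil c v : set_system V := within [set u | adj c u /\ u <> v] (nbhs v).

Lemma pencil_proper c v : pencil_limit c v -> ProperFilter (pencil c v).
Proof.
move=> lim; apply: Build_ProperFilter_ex => P vP.
have [x [/eqP xv cx]] := lim _ vP; move/(_ (conj cx xv)) => Px.
by exists x.
Qed.

Lemma pencil_cvg c v : id @ pencil c v --> v.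
Proof. by move=> U vU; exact: cvg_within. Qed.

Lemma pencil_adj c v : \forall t \near pencil c v, adj c t /\ t <> v.
Proof. exact: withinT. Qed.

(** The perspectivity [t |-> join p t] from the neighbours of [m] to those of [p]
    maps [q] to [l]; it is continuous and injective, hence maps vertices near [q]
    but different from it to vertices near [l] but different from it. *)
Lemma pencil_limit_perspective p l q m : adj p l -> adj l q -> adj q m ->
  p <> q -> l <> m -> pencil_limit m q -> pencil_limit p l.
Proof.
move=> pl lq qm pq lm /pencil_proper Fproper U lU.
have tpq : typ p = typ q by apply: adj2_typ lq; exact: adjC.
have pJ : \forall t \near pencil m q, adj (join p t) p /\ adj (join p t) t.
  apply: filterS (pencil_adj m q) => t [mt _]; apply: joinP; rewrite tpq.
  by apply: adj2_typ mt; exact: adjC.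
have Jl : join p @ pencil m q --> l.
  apply: (join_cvg (a := cst p) (b := id) _ _ _ pq) => //.
  - exact: cvg_cst.
  - exact: pencil_cvg.
  - exact: adjC.
  - by apply: filterS pJ => t [].
  - by apply: filterS pJ => t [].
have JU : \forall t \near pencil m q, U (join p t) by exact: Jl.
have [t [Ut [[Jp Jt] [mt tq]]]] :=
  filter_ex (filterI JU (filterI pJ (pencil_adj m q))).
exists (join p t); split=> //=; last exact: adjC.
apply/eqP => Jl'; rewrite Jl' in Jt; apply: tq.
by apply: (join_uniq lm) => //; exact: adjC.
Qed.

Lemma not_pencil_limit c v :
  ~ pencil_limit c v -> \forall y \near v, adj c y -> y = v.
Proof.
move=> nlim; apply: contrapT => nU; apply: nlim => U vU; apply: contrapT => ny.
apply: nU; apply: filterS vU => y Uy cy; apply: contrapT => /eqP yv.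
by apply: ny; exists y.
Qed.

(** A line [k] near [l] meets the line [a] near [q], thus in [q] itself. *)
Lemma isolated_in_pencil a q l : ~ pencil_limit a q ->
  adj l q -> adj q a -> l <> a -> \forall k \near l, typ k = typ l -> adj k q.
Proof.
move=> nlim lq qa la; pose F := within [set k | typ k = typ l] (nbhs l).
have FF : Filter F by exact: within_filter.
have tla : typ l = typ a by apply: adj2_typ qa; exact: adjC.
have FJ : \forall k \near F, adj (join k a) k /\ adj (join k a) a.
  have : \forall k \near F, typ k = typ l by exact: withinT.
  by apply: filterS => k kl; apply: joinP; rewrite kl.
have Jq : (fun k => join k a) @ F --> q.
  apply: (join_cvg (a := id) (b := cst a) _ _ _ la) => //.
  - by move=> U lU; exact: cvg_within.
  - exact: cvg_cst.
  - exact: adjC.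
  - by apply: filterS FJ => k [].
  - by apply: filterS FJ => k [].
have JU : \forall k \near F, adj a (join k a) -> join k a = q.
  exact: Jq _ (not_pencil_limit nlim).
have : \forall k \near F, adj k q.
  by apply: filterS2 FJ JU => k [Jk Ja] <-; exact: adjC.
by [].
Qed.

(** If there were no such pair, a chamber (v', l') close to (v, l) would have the
    line l' pass through two points q and r of l, so that l' = l, and then v' = v
    because v is isolated on l. *)
Lemma pencil_limit_ex (v : V) : exists c w, adj c w /\ pencil_limit c w.
Proof.
apply: contrapT => nlim.
have {}nlim c w : adj c w -> ~ pencil_limit c w.
  by move=> ? ?; apply: nlim; exists c, w.
have [l pl _] := adj_other v v; have lp := adjC pl.
have [q [lq qp _]] := plane_thick l v v; have [r [lr rp rq]] := plane_thick l v q.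
have near_l s : adj l s -> \forall k \near l, typ k = typ l -> adj k s.
  move=> ls; have [a sa al] := adj_other s l.
  exact: isolated_in_pencil (nlim _ _ (adjC sa)) ls sa (nesym al).
have vl := not_pencil_limit (nlim _ _ lp).
have [v' [l' [Uv' [l'q l'r] v'l' tl]]] :=
  edge_limit pl vl (filterI (near_l _ lq) (near_l _ lr)).
have ll : l' = l.
  by apply: (join_uniq (nesym rq)) => //; [exact: l'q|exact: l'r].
by rewrite ll in v'l' *; case; split=> //; apply: Uv'; exact: adjC.
Qed.

(** Two perspectivities along the path c - v - l - p and then along
    p - l - v - d, where thickness provides a neighbour [l] of [v] different from
    both [c] and [d]. *)
Lemma pencil_limit_recenter c v :
  adj c v -> pencil_limit c v -> forall d, adj d v -> pencil_limit d v.
Proof.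
move=> cv lim d dv; have [l [vl lc ld]] := plane_thick v c d.
have [p lp pv] := adj_other l v.
have vc := adjC cv; have pl := adjC lp; have lv := adjC vl.
have limpl := pencil_limit_perspective pl lv vc pv lc lim.
exact: (pencil_limit_perspective dv vl lp (nesym ld) (nesym pv)).
Qed.

Lemma pencil_limit_adj v w : adj v w ->
  (forall c, adj c v -> pencil_limit c v) ->
  forall c, adj c w -> pencil_limit c w.
Proof.
move=> vw limv; have [m vm mw] := adj_other v w; have [p wp pv] := adj_other w v.
have lim := limv _ (adjC vm); have pw := adjC wp.
apply: (pencil_limit_recenter pw).
exact: (pencil_limit_perspective pw (adjC vw) vm pv (nesym mw)).
Qed.

Lemma pencil_limitT c v : adj c v -> pencil_limit c v.
Proof.
have [d [w [dw limw]]] := pencil_limit_ex v.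
have {}limw e : adj e w -> pencil_limit e w.
  exact: pencil_limit_recenter dw _ _.
have same u : typ u = typ w -> forall c, adj c u -> pencil_limit c u.
  move=> /join_ex[x xu xw]; apply: (pencil_limit_adj xu).
  exact: (pencil_limit_adj (adjC xw)).
have [/same + |/eqP vw] := eqVneq (typ v) (typ w); first exact.
have [u vu _] := adj_other v v; apply: (pencil_limit_adj (adjC vu)); apply: same.
by apply: ord2_neq_eq vw; exact/nesym/adj_typ.
Qed.

Lemma pencil_neq c v w : \forall t \near pencil c v, t <> w.
Proof.
have [->|/eqP vw] := eqVneq w v.
  by apply: filterS (pencil_adj c v) => t [].
by apply: pencil_cvg; exact: near_neq (nesym vw).
Qed.

(** * Closed walks of length 6 are limits of injective ones *)

Definition walk (x : 'I_6 -> V) := forall i, adj (x i) (x (ordS i)).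

Definition injective_walks (x : 'I_6 -> V) : set {ptws 'I_6 -> V} :=
  [set y | [/\ walk y, injective y & forall i, typ (y i) = typ (x i)]].

(** The approximating walks are to have the types of [x], since only such walks
    correspond to morphisms. *)
Definition approximable (x : 'I_6 -> V) := closure (injective_walks x) x.

Definition hex (a b c d e f : V) : 'I_6 -> V :=
  fun i => nth a [:: a; b; c; d; e; f] i.

Lemma hexE x : x = hex (x ord0) (x (inord 1)) (x (inord 2)) (x (inord 3))
  (x (inord 4)) (x (inord 5)).
Proof.
apply/funext; case=> [[|[|[|[|[|[|i]]]]]] i6] //; rewrite /hex /=; congr (x _);
  by apply/val_inj; rewrite /= ?inordK.
Qed.

Lemma walk_hexP a b c d e f : walk (hex a b c d e f) <->
  [/\ adj a b, adj b c, adj c d & [/\ adj d e, adj e f & adj f a]].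
Proof.
split=> [w|[ab bc cd [de ef fa]]]; last first.
  by case=> [[|[|[|[|[|[|i]]]]]] i6].
have w' n (n6 : (n < 6)%N) : adj (nth a [:: a; b; c; d; e; f] n)
    (nth a [:: a; b; c; d; e; f] (n.+1 %% 6)%N) by exact: (w (Ordinal n6)).
by split; [exact: (w' 0)|exact: (w' 1)|exact: (w' 2)|split];
  [exact: (w' 3)|exact: (w' 4)|exact: (w' 5)].
Qed.

Lemma walk_typ x y : walk x -> walk y -> y ord0 = x ord0 ->
  forall i, typ (y i) = typ (x i).
Proof.
move=> wx wy xy0.
have step i : typ (y i) = typ (x i) -> typ (y (ordS i)) = typ (x (ordS i)).
  move=> e; have /adj_typ yi := wy i; have /adj_typ xi := wx i.
  by apply: ord2_neq_eq xi; rewrite -e; exact: nesym.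
case=> n; elim: n => [|n IHn] n6.
  by rewrite (_ : Ordinal n6 = ord0) ?xy0//; exact/val_inj.
have n6' : (n < 6)%N by exact: ltnW.
rewrite (_ : Ordinal n6 = ordS (Ordinal n6')); first exact: step.
by apply/val_inj; rewrite /= modn_small.
Qed.

(** Vertices at odd distance in the walk have different types, so only equalities
    at distance 2 need to be excluded. *)
Lemma hex_inj a b c d e f : walk (hex a b c d e f) ->
  a <> c -> c <> e -> e <> a -> b <> d -> d <> f -> f <> b ->
  injective (hex a b c d e f).
Proof.
move=> /walk_hexP[/adj_typ ab /adj_typ bc /adj_typ cd].
move=> [/adj_typ de /adj_typ ef /adj_typ fa] ac ce ea bd df fb.
have tac := ord2_neq_eq ab bc; have tce := ord2_neq_eq cd de.
have tbd := ord2_neq_eq bc cd.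
have tdf := ord2_neq_eq de ef.
case=> [[|[|[|[|[|[|i]]]]]] i6] // [[|[|[|[|[|[|j]]]]]] j6] //; rewrite /hex /= => xy;
  solve [exact/val_inj | by case: ac | by case: ce | by case: ea
       | by case: bd | by case: df | by case: fb | by exfalso; congruence].
Qed.

Lemma hex_cvg (T : Type) (F : set_system T) (a b c d e f : T -> V)
    a0 b0 c0 d0 e0 f0 :
  a @ F --> a0 -> b @ F --> b0 -> c @ F --> c0 -> d @ F --> d0 ->
  e @ F --> e0 -> f @ F --> f0 ->
  forall i, (fun t => hex (a t) (b t) (c t) (d t) (e t) (f t) i) @ F
    --> hex a0 b0 c0 d0 e0 f0 i.
Proof. by move=> ? ? ? ? ? ? [[|[|[|[|[|[|i]]]]]] i6]. Qed.

(** Approximations may be chained: a limit of approximable walks is approximable.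
    A common origin makes the types of all these walks agree. *)
Lemma approximable_limit (T : Type) (F : set_system T) (y : T -> 'I_6 -> V) x :
  ProperFilter F -> walk x -> (forall i, (fun t => y t i) @ F --> x i) ->
  (forall t, y t ord0 = x ord0) ->
  (\forall t \near F, walk (y t) /\ approximable (y t)) -> approximable x.
Proof.
move=> FF wx yx y0 Fy.
apply: (@closed_cvg T {ptws 'I_6 -> V} F FF y
  (closure (injective_walks x))).
- exact: closed_closure.
- apply: filterS Fy => t [wy]; rewrite /approximable.
  suff -> : injective_walks (y t) = injective_walks x by [].
  have typ_yx := walk_typ wx wy (y0 t).
  by apply/seteqP; split=> z [wz zi tz]; split=> // i; rewrite tz ?typ_yx.
- by apply: ptws_cvg => i; exact: yx.
Qed.

Lemma approximable_rot a b c d e f :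
  approximable (hex b c d e f a) -> approximable (hex a b c d e f).
Proof.
move=> app U Ux.
pose r (z : {ptws 'I_6 -> V}) : {ptws 'I_6 -> V} := z \o @ord_pred 6.
have rc : continuous r.
  move=> z; have FF : Filter (r @ z) by apply: fmap_filter; exact: nbhs_filter.
  apply: ptws_cvg => i.
  exact: (@proj_continuous 'I_6 (fun=> V) (ord_pred i) z).
have rx : r (hex b c d e f a) = hex a b c d e f.
  by apply/funext; case=> [[|[|[|[|[|[|i]]]]]] i6].
have /app [z [[wz zi zt] Uz]] :
    nbhs (hex b c d e f a : {ptws 'I_6 -> V}) (r @^-1` U).
  by apply: rc; rewrite rx.
exists (r z); split=> //; split=> [i|i j /zi|i].
- by rewrite /r /=; have := wz (ord_pred i); rewrite ord_predK ordSK.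
- by move/(can_inj (@ord_predK 6)).
- by rewrite -rx /r /= zt.
Qed.

Lemma walk_rot a b c d e f : walk (hex a b c d e f) -> walk (hex b c d e f a).
Proof. by move=> /walk_hexP[ab bc cd [de ef fa]]; apply/walk_hexP. Qed.

Lemma injective_approximable x : walk x -> injective x -> approximable x.
Proof. by move=> wx xi; apply: subset_closure. Qed.

(** The approximating walks are p, m, t, join t q, q, l with t near p on m. *)
Lemma approximable_bent p m l q :
  walk (hex p m p l q l) -> m <> l -> q <> p ->
  approximable (hex p m p l q l).
Proof.
move=> w ml qp; have /walk_hexP[pm mp pl [lq ql lp]] := w.
have Fproper := pencil_proper (pencil_limitT mp).
have tpq : typ p = typ q by exact: adj2_typ lp lq.
have FJ : \forall t \near pencil m p, adj (join t q) t /\ adj (join t q) q.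
  apply: filterS (pencil_adj m p) => t [mt _]; apply: joinP.
  by rewrite -tpq; exact: adj2_typ mt mp.
have Jl : (fun t => join t q) @ pencil m p --> l.
  apply: (join_cvg (a := id) (b := cst q) _ _ _ (nesym qp)) => //.
  - exact: pencil_cvg.
  - exact: cvg_cst.
  - by apply: filterS FJ => t [].
  - by apply: filterS FJ => t [].
apply: (@approximable_limit _ _ (fun t => hex p m t (join t q) q l) _ Fproper)
  => //.
  by apply: hex_cvg => //; by [exact: cvg_cst|exact: pencil_cvg].
apply: filterS2 (pencil_adj m p) FJ => t [mt tp] [Jt Jq].
have nqm : ~ adj q m.
  by move=> qm; apply: qp; apply: (join_uniq ml).
have wt : walk (hex p m t (join t q) q l).
  by apply/walk_hexP; split=> //; exact: adjC.
split=> //; apply: injective_approximable => //; apply: hex_inj => //.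
- exact: nesym.
- by move=> tq; apply: nqm; rewrite -tq; exact: adjC.
- by move=> mJ; apply: nqm; rewrite mJ; exact: adjC.
- move=> Jl'; apply: tp; apply: (join_uniq ml) => //; first exact: adjC.
  by rewrite -Jl'; exact: adjC.
- exact: nesym.
Qed.

(** The approximating walks are p, b, join t b, t, join t f, f with t near d among
    the neighbours of some r <> p incident to d; such a t is not incident to p,
    since otherwise p and r would have two joins, d and t. *)
Lemma approximable_star3 p b d f : walk (hex p b p d p f) ->
  b <> d -> d <> f -> f <> b -> approximable (hex p b p d p f).
Proof.
move=> w bd df fb; have /walk_hexP[pb bp pd [dp pf fp]] := w.
have [r dr rp] := adj_other d p; have rd := adjC dr.
have Fproper := pencil_proper (pencil_limitT rd).
have FJ a : adj a p ->
    \forall t \near pencil r d, adj (join t a) t /\ adj (join t a) a.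
  move=> ap; apply: filterS (pencil_adj r d) => t [rt _]; apply: joinP.
  by rewrite (adj2_typ rt rd); apply: adj2_typ pd _; exact: adjC.
have Jp a : adj a p -> a <> d -> (fun t => join t a) @ pencil r d --> p.
  move=> ap ad.
  apply: (join_cvg (a := id) (b := cst a) _ _ _ (nesym ad)) => //.
  - exact: pencil_cvg.
  - exact: cvg_cst.
  - exact: adjC.
  - by apply: filterS (FJ _ ap) => t [].
  - by apply: filterS (FJ _ ap) => t [].
pose y t := hex p b (join t b) t (join t f) f.
apply: (@approximable_limit _ _ y _ Fproper) => //.
  apply: hex_cvg; try by [exact: cvg_cst|exact: pencil_cvg].
    exact: Jp.
  by apply: Jp => //; exact: nesym.
apply: filterS3 (pencil_adj r d) (FJ _ bp) (FJ _ fp).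
move=> t [rt td] [Jb Jb'] [Jf Jf'].
have npt : ~ adj p t by move=> pt; apply: rp; apply: (join_uniq td).
have wt : walk (hex p b (join t b) t (join t f) f).
  by apply/walk_hexP; split=> //; [exact: adjC|split=> //; exact: adjC].
split=> //; apply: injective_approximable => //; apply: hex_inj => //.
- by move=> pJ; apply: npt; rewrite pJ.
- move=> JJ; apply: npt; suff -> : p = join t b by [].
  by apply: (join_uniq fb) => //; rewrite JJ.
- by move=> Jp'; apply: npt; rewrite -Jp'.
- by move=> bt; apply: npt; rewrite -bt.
- by move=> tf; apply: npt; rewrite tf.
Qed.

(** Moving [d], then [b], among the neighbours of [p] makes b, d, f distinct. *)
Lemma approximable_star p b d f :
  walk (hex p b p d p f) -> approximable (hex p b p d p f).
Proof.
have star2 g : walk (hex p b p g p f) -> g <> f -> approximable (hex p b p g p f).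
  move=> w gf; have /walk_hexP[pb bp pg [gp pf fp]] := w.
  have Fproper := pencil_proper (pencil_limitT pb).
  apply: (@approximable_limit _ _ (fun t => hex p t p g p f) _ Fproper) => //.
    by apply: hex_cvg; by [exact: cvg_cst|exact: pencil_cvg].
  apply: filterS3 (pencil_adj p b) (pencil_neq p b g) (pencil_neq p b f).
  move=> t [pt _] tg tf.
  have wt : walk (hex p t p g p f) by apply/walk_hexP; split=> //; exact: adjC.
  by split=> //; apply: approximable_star3 => //; exact: nesym.
move=> w; have /walk_hexP[pb bp pd [dp pf fp]] := w.
have Fproper := pencil_proper (pencil_limitT pd).
apply: (@approximable_limit _ _ (fun t => hex p b p t p f) _ Fproper) => //.
  by apply: hex_cvg; by [exact: cvg_cst|exact: pencil_cvg].
apply: filterS2 (pencil_adj p d) (pencil_neq p d f) => t [pt _] tf.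
have wt : walk (hex p b p t p f).
  by apply/walk_hexP; split=> //; split=> //; exact: adjC.
by split=> //; exact: star2.
Qed.

Lemma approximable_fold p m d q f :
  walk (hex p m p d q f) -> approximable (hex p m p d q f).
Proof.
move=> w; have /walk_hexP[pm mp pd [dq qf fp]] := w.
have [qp|/eqP qp] := eqVneq q p.
  by rewrite qp in w *; exact: approximable_star.
have fd : f = d by apply: (join_uniq qp) => //; exact: adjC.
rewrite fd in w *.
have [md|/eqP md] := eqVneq m d; last exact: approximable_bent.
(* All the lines are equal to d: this is the star of centre d. *)
by rewrite md in w *; apply/approximable_rot/approximable_star/walk_rot.
Qed.

Lemma walk_approximable x : walk x -> approximable x.
Proof.
rewrite (hexE x); set a := x _; set b := x _; set c := x _; set d := x _.
set e := x _; set f := x _ => w0.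
have w1 := walk_rot w0; have w2 := walk_rot w1; have w3 := walk_rot w2.
have w4 := walk_rot w3; have w5 := walk_rot w4.
have [ac|/eqP ac] := eqVneq a c.
  by rewrite ac in w0 *; exact: approximable_fold.
have [bd|/eqP bd] := eqVneq b d.
  by apply: approximable_rot; rewrite bd in w1 *; exact: approximable_fold.
have [ce|/eqP ce] := eqVneq c e.
  by do 2!apply: approximable_rot; rewrite ce in w2 *; exact: approximable_fold.
have [df|/eqP df] := eqVneq d f.
  by do 3!apply: approximable_rot; rewrite df in w3 *; exact: approximable_fold.
have [ea|/eqP ea] := eqVneq e a.
  by do 4!apply: approximable_rot; rewrite ea in w4 *; exact: approximable_fold.
have [fb|/eqP fb] := eqVneq f b.
  by do 5!apply: approximable_rot; rewrite fb in w5 *; exact: approximable_fold.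
by apply: injective_approximable => //; exact: hex_inj.
Qed.

End Plane.

(** * Convergence of morphisms, and the case of type A1 *)

Section Mor.
Variables (d : nat) (I : topBuilding d) (A : set {fset I}).

Lemma Mor_cvg (T : Type) (F : set_system T) (g : T -> Mor A) (f : Mor A) :
  Filter F ->
  (forall v : verts A, (fun t => mor_fun (g t) v) @ F --> mor_fun f v) ->
  g @ F --> f.
Proof.
move=> FF gf; have FgF : Filter (g @ F) by exact: fmap_filter.
apply: initial_cvg.
have FmgF : Filter (@mor_cham _ _ A @ (g @ F)) by exact: fmap_filter.
apply: ptws_cvg => C; apply: initial_cvg; apply: ptws_cvg => i.
exact: gf.
Qed.

Lemma Mor_inj_closure (T : Type) (F : set_system T) (g : T -> verts A -> I)
    (f : Mor A) :
  ProperFilter F -> (forall v, (fun t => g t v) @ F --> mor_fun f v) ->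
  (\forall t \near F, @mor_set _ _ A (g t)) -> (\forall t \near F, injective (g t)) ->
  closure (Mor_inj A) f.
Proof.
move=> FF gf gm gi.
(* The value f for the t such that g t is no morphism is arbitrary. *)
pose G t : Mor A := if pselect (@mor_set _ _ A (g t)) is left m
  then SigSub (mem_set m) : @mor_set _ _ A else f.
have GE t : @mor_set _ _ A (g t) -> mor_fun (G t) = g t.
  by rewrite /G; case: pselect.
apply: (@closure_filter _ _ F G).
  apply: Mor_cvg => v U /gf gU; apply: filterS2 gm gU => t gt Ut.
  by rewrite /= GE.
by apply: filterS2 gm gi => t /GE Gt git; rewrite /Mor_inj /= Gt.
Qed.

End Mor.

Lemma Mor_inj_dense_A1 (d : nat) (I : topBuilding d) (A : set {fset I}) :
  apartment A -> type_A1 I -> isolated [set: I] = set0 ->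
  closure (Mor_inj A) = [set: Mor A].
Proof.
move=> Aap [d0 A1] iso; subst d; apply/seteqP; split=> // f _.
have [x [y [xy AE]]] := (A1 A).1 Aap.
have Ax : A [fset x]%fset by rewrite AE; left.
have Ay : A [fset y]%fset by rewrite AE; right.
have AP s : A s -> s = [fset x]%fset \/ s = [fset y]%fset by rewrite AE.
have vA v : verts A v -> v = x \/ v = y.
  by move=> [s /AP[->|->]]; rewrite inE => /eqP ->; [left|right].
have vx : x \in verts A by apply/mem_set; exists [fset x]%fset; rewrite ?inE.
have vy : y \in verts A by apply/mem_set; exists [fset y]%fset; rewrite ?inE.
pose x' : verts A := SigSub vx; pose y' : verts A := SigSub vy.
have cases (v : verts A) : v = x' \/ v = y'.
  by have [e|e] := vA _ (set_valP v); [left|right]; exact: val_inj.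
have [fxy|/eqP fxy] := eqVneq (mor_fun f x') (mor_fun f y'); last first.
  apply: subset_closure => v w; case: (cases v) => ->; case: (cases w) => -> //.
  by move/esym.
have FF := not_isolated_dnbhs (mor_fun f x') iso.
pose g (t : I) (v : verts A) := if \val v == x then t else mor_fun f v.
have gx t : g t x' = t by rewrite /g eqxx.
have gy t : g t y' = mor_fun f y' by rewrite /g /=; case: eqP => // /esym.
apply: (@Mor_inj_closure _ _ _ _ ((mor_fun f x')^') g f FF).
- move=> v; case: (cases v) => ->.
    under eq_fun do rewrite gx; exact: cvg_within.
  by under eq_fun do rewrite gy; exact: cvg_cst.
- apply: filterE => t; split=> [v|s As]; first by rewrite !ord1.
  suff [v ->] : exists v, s = [fset v]%fset.
    by rewrite imfset_fset1; exact: simp_vertex.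
  have sE v : [fset \val u | u in s]%fset = [fset \val v]%fset -> s = [fset v]%fset.
    move=> /fsetP e; apply/fsetP => u; have := e (\val u).
    by rewrite mem_imfset ?inE//; exact: val_inj.
  by case: (AP _ As) => e; [exists x'|exists y']; exact: sE.
- have : \forall t \near (mor_fun f x')^', t != mor_fun f x'.
    by rewrite /dnbhs; exact: withinT.
  apply: filterS => t /eqP tx v w; case: (cases v) => ->; case: (cases w) => -> //;
    rewrite gx gy -fxy => e; by case: tx.
Qed.

(** * The projective plane of a building of type A2 *)

Definition incident (d : nat) (I : topBuilding d) (v w : I) : Prop :=
  v <> w /\ simp [fset v; w]%fset.

(** Adjacency in the 6-cycle. *)
Definition next_to (i j : 'I_6) := (j == ordS i) || (i == ordS j).

(** A 6-cycle contains no 4-cycle. *)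
Lemma hex_square (i j k l : 'I_6) :
  next_to k i -> next_to k j -> next_to l i -> next_to l j -> (i == j) || (k == l).
Proof.
move: i k j l; case=> [[|[|[|[|[|[|i]]]]]] ?] // [[|[|[|[|[|[|k]]]]]] ?] // j l;
  by case: j l => [[|[|[|[|[|[|j]]]]]] ?] // [[|[|[|[|[|[|l]]]]]] ?].
Qed.

Lemma hex_distance (i j : 'I_6) :
  [|| j == i, next_to i j, j == ordS (ordS i), i == ordS (ordS j)
    | j == ordS (ordS (ordS i))].
Proof. by case: i j => [[|[|[|[|[|[|i]]]]]] ?] // [[|[|[|[|[|[|j]]]]]] ?]. Qed.

Lemma ordS_neq_pred (i : 'I_6) : ordS i <> ord_pred i.
Proof. by case: i => [[|[|[|[|[|[|i]]]]]] ?]. Qed.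

Section TypeA2.
Variable I : topBuilding 1.
Hypothesis A2 : type_A2 I.
Hypothesis cham_limit : isolated [set: Cham I] = set0.

Local Notation adj := (@incident 1 I).
Local Notation tp := (@typ 1 I).

Lemma incidentC v w : adj v w -> adj w v.
Proof. by move=> [vw s]; split; [exact: nesym|rewrite fsetUC]. Qed.

Lemma incident_typ v w : adj v w -> tp v <> tp w.
Proof.
by move=> [vw /typ_inj s] e; apply: vw; apply: s; rewrite // !inE eqxx ?orbT.
Qed.

Lemma incident_simp v w : tp v <> tp w -> simp [fset v; w]%fset -> adj v w.
Proof. by move=> t s; split=> // e; apply: t; rewrite e. Qed.

Lemma hexagon_next (h : 'I_6 -> I) i j :
  next_to i j -> hexagon h [fset h i; h j]%fset.
Proof.
move=> /orP[] /eqP ->; [exists i|exists j]; right => //; exact: fsetUC.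
Qed.

Lemma hexagon_vertex (h : 'I_6 -> I) v :
  injective h -> hexagon h [fset v]%fset -> exists i, v = h i.
Proof.
move=> hi [i [/fsetP/(_ v)|/fsetP/(_ (h i))]]; rewrite !inE eqxx.
  by move/esym/eqP; exists i.
by move/eqP; exists i.
Qed.

Lemma hexagon_edge (h : 'I_6 -> I) v w : injective h -> v <> w ->
  hexagon h [fset v; w]%fset -> exists i j, [/\ v = h i, w = h j & next_to i j].
Proof.
move=> hi vw [i [e|e]].
  case: vw; move/fsetP: e => e; have := e v; have := e w.
  by rewrite !inE !eqxx ?orbT => /esym/eqP -> /esym/eqP.
move/fsetP: e => e; have := e v; have := e w.
rewrite !inE !eqxx ?orbT => /esym/orP wE /esym/orP vE.
case: vE wE => /eqP vE [] /eqP wE; try by case: vw; rewrite vE wE.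
  by exists i, (ordS i); split=> //; apply/orP; left.
by exists (ordS i), i; split=> //; apply/orP; right.
Qed.

Lemma apartments_A2 : exists E, apartment_system 1 (@simp 1 I) E /\
  forall B, E B -> exists2 h : 'I_6 -> I, injective h & B = hexagon h.
Proof.
have [E sE] := simp_apartments I; exists E; split=> // B EB.
by apply: A2.2; exists E.
Qed.

Lemma hexagon_incident (h : 'I_6 -> I) i j : injective h ->
  hexagon h `<=` @simp 1 I -> next_to i j -> adj (h i) (h j).
Proof.
move=> hi hK ij; split; last by apply: hK; exact: hexagon_next.
by move/hi => e; move: ij; rewrite e; case: j {e} => [[|[|[|[|[|[|j]]]]]] ?].
Qed.

(** The apartments, given by parametrizations.  They are full subcomplexes (second
    item): if two vertices of an apartment are adjacent in the building, an
    isomorphism from an apartment that contains their edge, and fixing both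
    vertices, carries this edge into the given apartment. *)
Lemma hexagon_full : exists E : set ('I_6 -> I), [/\
   forall h, E h -> injective h,
   forall h i j, E h -> (next_to i j <-> adj (h i) (h j)) &
   forall s t, simp s -> simp t ->
     exists2 h, E h & hexagon h s /\ hexagon h t].
Proof.
have [E [[EK Econn Eiso] Ehex]] := apartments_A2.
exists [set h | injective h /\ E (hexagon h)]; split.
- by move=> h [].
- move=> h i j [hi Eh]; have [hK _] := EK _ Eh.
  split; [exact: hexagon_incident|move=> [hij s]].
  have [B [EB Bs _]] := Econn _ _ s s.
  have [h' h'i BE] := Ehex _ EB.
  have B1 v : v \in [fset h i; h j]%fset -> B [fset v]%fset.
    move=> vs; have [i' [j' [e e' _]]] :
        exists i' j', [/\ h i = h' i', h j = h' j' & next_to i' j'].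
      by apply: hexagon_edge => //; rewrite -BE.
    by move: vs; rewrite BE !inE e e' => /orP[]/eqP ->; [exists i'|exists j']; left.
  have h1 k : hexagon h [fset h k]%fset by exists k; left.
  have [f [[_ hE] fid]] : exists f, complex_iso f B (hexagon h) /\
      forall v, v \in [fset h i]%fset \/ v \in [fset h j]%fset -> f v = v.
    by apply: Eiso; rewrite //; apply: B1; rewrite !inE eqxx ?orbT.
  have : hexagon h [fset h i; h j]%fset.
    rewrite hE; exists [fset h i; h j]%fset => //.
    by rewrite imfset_fset2 !fid// !inE eqxx; [right|left].
  by move=> /(hexagon_edge hi hij)[i' [j' [/hi -> /hi -> ]]].
- move=> s t Ks Kt; have [B [EB Bs Bt]] := Econn _ _ Ks Kt.
  by have [h hi BE] := Ehex _ EB; exists h; [split=> //; rewrite -BE|rewrite -BE].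
Qed.

(** Two distinct vertices of the same type in a hexagon have a common neighbour.
    If u and u' are common neighbours of v and w, an apartment containing the
    edges uv and u'w contains the closed walk (v, u, w, u') since it is full, and
    a hexagon has no 4-cycle. *)
Lemma plane_of_A2 : projective_plane adj tp.
Proof.
have [E [Einj Eadj Econn]] := hexagon_full.
have nextS (i : 'I_6) : next_to i (ordS i) by apply/orP; left.
have nextP (i : 'I_6) : next_to i (ord_pred i).
  by apply/orP; right; rewrite ord_predK.
have nextC (i j : 'I_6) : next_to i j -> next_to j i by rewrite /next_to orbC.
split.
- exact: incidentC.
- exact: incident_typ.
- move=> v w tvw; have [h Eh [hv hw]] := Econn _ _ (simp_vertex v) (simp_vertex w).
  have hi := Einj _ Eh.
  have [i vE] := hexagon_vertex hi hv.
  have [j wE] := hexagon_vertex hi hw.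
  have adjh k l : next_to k l -> adj (h k) (h l) by move/(Eadj _ _ _ Eh).
  have tS k : tp (h k) <> tp (h (ordS k)) by exact/incident_typ/adjh.
  have tSS k : tp (h k) = tp (h (ordS (ordS k))) by exact: ord2_neq_eq (tS k) (tS _).
  subst v w.
  case/or4P: (hex_distance i j) => [/eqP ->|ij|/eqP ->|/orP[/eqP ->|/eqP jE]].
  + by exists (h (ordS i)); exact/adjh/nextC.
  + by have := incident_typ (adjh _ _ ij).
  + by exists (h (ordS i)); apply: adjh => //; exact: nextC.
  + by exists (h (ordS j)); apply: adjh => //; exact: nextC.
  + by case: (tS i); rewrite tvw jE -tSS.
- move=> v w u u' vw uv uw u'v u'w.
  have [h Eh [hu hu']] := Econn _ _ uv.2 u'w.2; have hi := Einj _ Eh.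
  have [k [i [uE vE _]]] := hexagon_edge hi uv.1 hu.
  have [l [j [u'E wE _]]] := hexagon_edge hi u'w.1 hu'.
  subst u u' v w; congr h.
  have nt i' j' : adj (h i') (h j') -> next_to i' j' by move/(Eadj _ _ _ Eh).
  have := hex_square (nt _ _ uv) (nt _ _ uw) (nt _ _ u'v) (nt _ _ u'w).
  by case/orP => /eqP // ij; case: vw; rewrite ij.
- move=> v w; have [h Eh [hv _]] := Econn _ _ (simp_vertex v) (simp_vertex v).
  have hi := Einj _ Eh; have [i ->] := hexagon_vertex hi hv.
  have adjh k l : next_to k l -> adj (h k) (h l) by move/(Eadj _ _ _ Eh).
  have [wE|/eqP wE] := eqVneq (h (ordS i)) w; last first.
    by exists (h (ordS i)) => //; exact: adjh.
  exists (h (ord_pred i)); first exact: adjh.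
  by rewrite -wE => /hi /esym/ordS_neq_pred.
Qed.

Lemma incident_closed : closed [set vw : I * I | adj vw.1 vw.2].
Proof.
pose c (vw : I * I) : {ptws 'I_2 -> I} :=
  fun i => if i == ord0 then vw.1 else vw.2.
have cc : continuous c.
  move=> [v w].
  have FF : Filter (c @ (v, w)) by apply: fmap_filter; exact: nbhs_filter.
  apply: ptws_cvg => i.
  suff : (fun vw => c vw i) @ (v, w) --> c (v, w) i by [].
  by rewrite /c; case: (i == ord0); [exact: cvg_fst|exact: cvg_snd].
have /(_ _ (@simp_closed 1 I 1 isT)) := (continuous_closedP c).1 cc.
congr closed; apply/seteqP; split=> -[v w];
  rewrite /ordered_simplices /incident /= (@tuple_simplex2 _ _ ord0 ord_max)//.
  by move=> [ci s]; split=> // vw; have /(congr1 val) := ci ord0 ord_max vw.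
move=> [vw s]; split=> // -[[|[|i]] ?] -[[|[|j]] ?] //= e; try exact/val_inj.
by case: vw.
Qed.

Lemma incident_cham v w :
  adj v w -> exists2 C : Cham I, cvertex C (tp v) = v & cvertex C (tp w) = w.
Proof.
move=> vw; have tvw := incident_typ vw.
pose c : {ptws 'I_2 -> I} := fun i => if i == tp v then v else w.
have cv : c (tp v) = v by rewrite /c eqxx.
have cw : c (tp w) = w by rewrite /c; case: eqP => // /esym.
suff cC : Cham_set c by exists (SigSub (mem_set cC)).
split=> [i|]; last by rewrite (tuple_simplex2 _ tvw) cv cw; exact: vw.2.
by rewrite /c; case: eqP => [->//|iv]; exact: esym (ord2_neq_eq iv tvw).
Qed.

Lemma cvertex_continuous i : continuous (fun C : Cham I => cvertex C i).
Proof.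
move=> C U /(@proj_continuous 'I_2 (fun=> I) i (val C)).
exact: (@initial_continuous (@Cham_set 1 I) _ set_val C).
Qed.

Lemma incident_edge_limit v w : adj v w ->
  forall P Q, nbhs v P -> nbhs w Q -> exists v' w',
    [/\ P v', Q w', adj v' w', tp w' = tp w & ~ (v' = v /\ w' = w)].
Proof.
move=> vw P Q vP wQ; have tvw := incident_typ vw.
have [C Cv Cw] := incident_cham vw.
have CP : \forall D \near C, P (cvertex D (tp v)).
  by apply: cvertex_continuous; rewrite Cv.
have CQ : \forall D \near C, Q (cvertex D (tp w)).
  by apply: cvertex_continuous; rewrite Cw.
have FF := not_isolated_dnbhs C cham_limit.
have DC : \forall D \near C^', D <> C.
  have : \forall D \near C^', D != C by rewrite /dnbhs; exact: withinT.
  by apply: filterS => D /eqP.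
have [D [nDC [PD QD]]] :=
  filter_ex (filterI DC (cvg_within _ (filterI CP CQ))).
have [tD sD] := set_valP D.
exists (cvertex D (tp v)), (cvertex D (tp w)); split=> //.
- by apply: incident_simp; rewrite ?tD // -(tuple_simplex2 _ tvw).
- exact: tD.
- move=> [Dv Dw]; apply: nDC; apply: val_inj; apply/funext => i /=.
  have [->|/eqP iv] := eqVneq i (tp v); first by rewrite [LHS]Dv [RHS]Cv.
  by rewrite (ord2_neq_eq iv tvw) [LHS]Dw [RHS]Cw.
Qed.

(** A type-preserving automorphism that maps a chamber containing [v] to one
    containing [w] maps [v] to [w]. *)
Lemma thin_at_typ (R : realType) v w : top_strongly_transitive R I ->
  tp v = tp w -> thin_at adj v -> thin_at adj w.
Proof.
move=> trans tvw [u [u' uu']].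
have [E [sE _]] := apartments_A2.
have cham x : exists C B, [/\ apartment B, B (csimplex C) & cvertex C (tp x) = x].
  have [y xy _] := adj_other plane_of_A2 x x.
  have [C Cx _] := incident_cham xy; have [_ sC] := set_valP C.
  have [_ /(_ _ _ sC sC) [B [EB BC _]] _] := sE.
  by exists C, B; split=> //; exists E.
have [C [B [Bap BC Cv]]] := cham v.
have [C' [B' [Bap' BC' Cw]]] := cham w.
have [g _ [_ gC]] := trans _ _ _ _ Bap Bap' BC BC'.
have gv : g v = w.
  have : g v \in csimplex C'.
    by rewrite -gC; apply/imfsetP; exists v => //; apply/imfsetP; exists (tp v).
  move/imfsetP => [i _ /= gvi]; have [tC' _] := set_valP C'.
  by rewrite gvi -Cw; congr (cvertex C' _); rewrite -tvw -(aut_typ g) gvi tC'.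
exists (g u), (g u') => x [wx s].
have : adj v (aut_inv g x).
  split; first by move=> e; apply: wx; rewrite -gv e aut_invK.
  by apply/(aut_simp g); rewrite imfset_fset2 gv aut_invK.
by move/uu' => [e|e]; [left|right]; rewrite -e aut_invK.
Qed.

Lemma Mor_inj_dense_A2 (R : realType) (A : set {fset I}) :
  compact [set: I] -> apartment A -> top_strongly_transitive R I ->
  closure (Mor_inj A) = [set: Mor A].
Proof.
move=> Icpt Aap trans; apply/seteqP; split=> // f _.
have [h hi AE] := A2.2 _ Aap; have AP s : A s <-> hexagon h s by rewrite AE.
have AK : hexagon h `<=` @simp 1 I.
  by rewrite -AE; case: Aap => E [/(_ A) + _ _] EA => /(_ EA)[].
have hA i : h i \in verts A.
  by apply/mem_set; exists [fset h i]%fset; rewrite ?AE ?inE//; exists i; left.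
pose vtx i : verts A := SigSub (hA i).
have idxP (v : verts A) : exists i, vtx i = v.
  have [s As vs] := set_valP v.
  suff [i e] : exists i, val v = h i by exists i; apply: val_inj.
  have /AP[i [sE|sE]] := As; move: vs; rewrite sE !inE.
    by move/eqP; exists i.
  by case/orP => /eqP; [exists i|exists (ordS i)].
pose idx (u : I) : 'I_6 := xget ord0 [set i | h i = u].
have idxK i : idx (h i) = i.
  by apply: hi; apply: (@xgetPex _ ord0 [set j | h j = h i]); exists i.
pose x i := mor_fun f (vtx i).
have [ft fs] := set_valP (f : @mor_set _ _ A).
have hadj i : adj (h i) (h (ordS i)).
  by apply: hexagon_incident => //; apply/orP; left.
have wx : walk adj x.
  move=> i; apply: incident_simp.
    by rewrite /x /mor_fun !ft /=; exact: incident_typ.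
  have := fs [fset vtx i; vtx (ordS i)]%fset; rewrite !imfset_fset2; apply.
  by apply/AP; exists i; right.
have clx := walk_approximable plane_of_A2 incident_closed Icpt
  incident_edge_limit (fun v w => @thin_at_typ R v w trans) wx.
set W := injective_walks adj tp x in clx.
pose F := within W (nbhs (x : {ptws 'I_6 -> I})).
have FF : ProperFilter F := within_nbhs_proper clx.
have near_W : \forall z \near F, W z by exact: withinT.
pose g (z : 'I_6 -> I) (v : verts A) := z (idx (val v)).
apply: (@Mor_inj_closure _ _ _ _ _ g f FF).
- move=> v; have [i <-] := idxP v; rewrite /g /= idxK -/(x i).
  move=> U /(@proj_continuous 'I_6 (fun=> I) i x) xU.
  by apply: (filterS (F := nbhs (x : {ptws 'I_6 -> I})) _ xU) => z zU _.
- move: near_W; apply: filterS => z [wz zi zt]; split=> [v|s As].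
    by have [i <-] := idxP v; rewrite /g /= idxK zt /x /mor_fun ft.
  have -> : [fset g z v | v in s]%fset =
      ((z \o idx) @` [fset val v | v in s])%fset.
    by rewrite -imfset_comp.
  have /AP[i [->|->]] := As.
    by rewrite imfset_fset1; exact: simp_vertex.
  by rewrite imfset_fset2 /= !idxK; exact: (wz i).2.
- move: near_W; apply: filterS => z [wz zi zt] v w /zi e.
  have [i vi] := idxP v; have [j wj] := idxP w.
  by move: e; rewrite -vi -wj /= !idxK => ->.
Qed.

End TypeA2.

Theorem theorem2 (R : realType) (d : nat) (I : topBuilding d)
    (A : set {fset I}) (I_compact : compact [set: I]) (A_apartment : apartment A) :
  (type_A1 I /\ isolated [set: I] = set0) \/
  (type_A2 I /\ isolated [set: Cham I] = set0 /\
   top_strongly_transitive R I /\ top_moufang R I) ->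
  closure (Mor_inj A) = [set: Mor A].
Proof.
move=> [[A1 iso]|[A2 [iso [trans _]]]]; first exact: Mor_inj_dense_A1.
by have [d1 _] := A2; subst d; exact: (@Mor_inj_dense_A2 I A2 iso R).
Qed.
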